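(* Let $n\ge 3$ be an integer and let $K_{1,n}$ be the star with $n$ leaves. Then $Z_g(K_{1,n})=n$ if $n$ is odd, and $Z_g(K_{1,n})=n-1$ if $n$ is even.
   Context: All graphs are finite and simple. The game: Let $G$ be a connected graph with at least one edge; initially all vertices are white. Alice (blue) and Bob (red) alternate turns, Alice first. On each turn the player makes exactly one move: a seed move (colour one white vertex with the player's colour) or a force move $u\to v$ (if a vertex $u$ of the player's colour has exactly one white neighbour $v$, colour $v$ with the player's colour). Being the unique white neighbour is with respect to all white vertices, irrespective of who coloured the others. If a white vertex is the target of one of the player's own legal forces, colouring it counts as a force move and not as a seed move. A move blocks a legal force $u\to v$ if that force is no longer legal after the move. Force Preservation Rule: considering the opponent's legal forces (those the opponent's coloured vertices could make) at the beginning of a turn, (i) a player may always perform one of their own legal forces, even if this blocks a force of the opponent; (ii) a seed move that blocks a legal force of the opponent is permitted only when every available seed move blocks at least one of the opponent's legal forces. The game ends when every vertex is coloured. Optimal play and $Z_g$: For a position $P$ define a set $\mathcal O(P)$ of pairs. If $P$ is terminal and Alice and Bob made $s_A$ and $s_B$ seed moves in total, then $\mathcal O(P)=\{(s_A,s_B)\}$. Otherwise let $\mathcal U(P)=\bigcup_m \mathcal O(P_m)$ over all legal moves $m$, where $P_m$ is the resulting position; $\mathcal O(P)$ is the set of all pairs in $\mathcal U(P)$ with minimum first coordinate if Alice is to move, and with minimum second coordinate if Bob is to move. Let $\mathcal O(G)=\mathcal O(P_0(G))$ for the initial position $P_0(G)$. The game zero forcing number is $Z_g(G)=\min\{s_A+s_B:(s_A,s_B)\in\mathcal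 O(G)\}$. *)

(* Defs.v *)
From Stdlib Require List.
From HB Require Import structures.
From mathcomp Require Import all_boot.

Set Implicit Arguments.
Unset Strict Implicit.
Unset Printing Implicit Defensive.

Record sgraph := SGraph {
  vertex :> finType;
  edge : rel vertex;
  edge_sym : symmetric edge;
  edge_irrefl : irreflexive edge }.

Variant player := Alice | Bob.

Definition bool_of_player p := if p is Alice then true else false.
Definition player_of_bool b := if b then Alice else Bob.

Lemma bool_of_playerK : cancel bool_of_player player_of_bool.
Proof. by case. Qed.

HB.instance Definition _ := Equality.copy player (can_type bool_of_playerK).

Definition opponent p := if p is Alice then Bob else Alice.

(* The definitions make sense for every finite simple graph; the game itself is
   only meant to be played on connected graphs with at least one edge. *)
Section Game.
Variable G : sgraph.

(* A colour is the player who owns it; [None] is white. The position carries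
   the number of seed moves each player has made so far. *)
Record position := Position {
  colour : {ffun G -> option player};
  turn : player;
  seedsA : nat;
  seedsB : nat }.

Definition initial : position := Position [ffun=> None] Alice 0 0.

Definition whites (P : position) : {set G} := [set v | colour P v == None].

Definition white_nbrs (P : position) (u : G) : {set G} :=
  [set v in whites P | edge u v].

Definition legal_force (p : player) (P : position) (u v : G) : bool :=
  (colour P u == Some p) && (white_nbrs P u == [set v]).

Variant move := Seed of G | Force of G & G.

Definition paint (P : position) (v : G) : {ffun G -> option player} :=
  [ffun x => if x == v then Some (turn P) else colour P x].

Definition play (P : position) (m : move) : position :=
  match m with
  | Seed v => Position (paint P v) (opponent (turn P))
                (seedsA P + (turn P == Alice)) (seedsB P + (turn P == Bob))
  | Force _ v => Position (paint P v) (opponent (turn P)) (seedsA P) (seedsB P)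
  end.

(* Colouring the target of one of the mover's own legal forces is a force move,
   so such a vertex is not available for a seed move. *)
Definition available_seed (P : position) (v : G) : bool :=
  (v \in whites P) && ~~ [exists u, legal_force (turn P) P u v].

Definition blocks (P : position) (m : move) : bool :=
  [exists u, exists v, legal_force (opponent (turn P)) P u v
                    && ~~ legal_force (opponent (turn P)) (play P m) u v].

(* The second conjunct is the Force Preservation Rule. *)
Definition legal_seed (P : position) (v : G) : bool :=
  available_seed P v &&
  (blocks P (Seed v) ==>
   [forall w, available_seed P w ==> blocks P (Seed w)]).

Definition legal_moves (P : position) : seq move :=
  [seq Seed v | v <- enum G & legal_seed P v] ++
  [seq Force uv.1 uv.2 | uv <- enum {: G * G}
                       & legal_force (turn P) P uv.1 uv.2].

Definition score (p : player) (o : nat * nat) : nat :=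
  if p is Alice then o.1 else o.2.

Definition best (p : player) (U : seq (nat * nat)) : seq (nat * nat) :=
  [seq o <- U | all (fun o' => score p o <= score p o') U].

Fixpoint outcomes_rec (k : nat) (P : position) : seq (nat * nat) :=
  if k is k'.+1 then
    best (turn P)
      (flatten [seq outcomes_rec k' (play P m) | m <- legal_moves P])
  else [:: (seedsA P, seedsB P)].

(* Sequences stand for finite sets of pairs. Each move colours exactly one
   white vertex, so the number of white vertices is the exact length of the
   rest of the game; [outcomesE] is the intended recursive definition. *)
Definition outcomes (P : position) : seq (nat * nat) :=
  outcomes_rec #|whites P| P.

Lemma legal_force_white p P u v : legal_force p P u v -> v \in whites P.
Proof.
case/andP=> _ /eqP/setP/(_ v); rewrite in_set1 eqxx.
by rewrite inE => /andP[].
Qed.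

Lemma whites_play P m : whites (play P m) =
  whites P :\ match m with Seed v | Force _ v => v end.
Proof.
by case: m => [v|u v]; apply/setP=> x; rewrite !inE ffunE; case: (x == v).
Qed.

Lemma size_whites_play P m :
  List.In m (legal_moves P) -> #|whites P| = #|whites (play P m)|.+1.
Proof.
have mem (T : eqType) (f : T -> move) (s : seq T) :
  List.In m (map f s) -> exists2 x, x \in s & m = f x.
  elim: s => //= x s IHs [<-|/IHs[y ys ->]]; first by exists x; rewrite ?mem_head.
  by exists y; rewrite // inE ys orbT.
rewrite whites_play => /List.in_app_iff[] /mem[].
  move=> v; rewrite mem_filter => /andP[/andP[/andP[wv _] _] _] ->.
  by rewrite (cardsD1 v) wv.
move=> [u v]; rewrite mem_filter => /andP[/legal_force_white wv _] ->.
by rewrite (cardsD1 v) wv.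
Qed.

Lemma outcomesE P :
  outcomes P = if whites P == set0 then [:: (seedsA P, seedsB P)]
               else best (turn P)
                      (flatten [seq outcomes (play P m) | m <- legal_moves P]).
Proof.
rewrite {1}/outcomes -cards_eq0.
case: #|whites P| (@size_whites_play P) => //= k sz.
congr (best _ (flatten _)); apply: List.map_ext_in => m /sz[->].
by [].
Qed.

Lemma legal_moves_neq0 P : whites P != set0 -> legal_moves P <> [::].
Proof.
case/set0Pn=> v wv; rewrite /legal_moves.
case def_s: [seq w <- _ | _] => //=; case def_f: [seq uv <- _ | _] => //= _.
have noseed w : ~~ legal_seed P w.
  apply/negP=> lw; have: w \in [seq w <- enum G | legal_seed P w].
    by rewrite mem_filter lw mem_enum.
  by rewrite def_s.
have noforce u w : ~~ legal_force (turn P) P u w.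
  apply/negP=> lw; have := mem_filter
    (fun uv => legal_force (turn P) P uv.1 uv.2) (u, w) (enum {: G * G}).
  by rewrite def_f lw mem_enum.
have av w : w \in whites P -> available_seed P w.
  by move=> ww; rewrite /available_seed ww; apply/existsPn=> u.
have bl w : available_seed P w -> blocks P (Seed w).
  move=> aw; have := noseed w; rewrite /legal_seed aw /=.
  by case: (blocks _ _).
have /negP[] := noseed v; rewrite /legal_seed av //=; apply/implyP=> _.
by apply/forallP=> w; apply/implyP/bl.
Qed.

Lemma best_neq0 p U : U <> [::] -> best p U <> [::].
Proof.
case: U => // o U _; have [x xU minx] :
    exists2 x, x \in o :: U & all (fun o' => score p x <= score p o') (o :: U).
  elim: U o => [|o' U IHU] o; first by exists o; rewrite ?mem_head //= leqnn.
  have [x xU minx] := IHU o'; have [le_ox|/ltnW le_xo] := leqP (score p o) (score p x).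
    exists o; rewrite ?mem_head //; apply/allP=> y; rewrite inE => /predU1P[-> //|yU].
    exact: leq_trans le_ox (allP minx _ yU).
  by exists x; [rewrite inE xU orbT | rewrite /= le_xo].
by move=> best0; have := mem_filter (fun x => all (fun o' => score p x <= score p o')
  (o :: U)) x (o :: U); rewrite -/(best p _) best0 minx xU.
Qed.

Lemma outcomes_neq0 P : outcomes P <> [::].
Proof.
have [k] := ubnP #|whites P|; elim: k P => // k IHk P leP.
rewrite outcomesE; case: ifPn => // /legal_moves_neq0.
case def_ms: (legal_moves P) => [|m ms] // _; apply: best_neq0 => /=.
have m_legal : List.In m (legal_moves P) by rewrite def_ms; left.
have := IHk (play P m); rewrite -(size_whites_play m_legal) => /(_ leP).
by case: (outcomes _).
Qed.

Lemma total_seeds_ex :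
  exists s, s \in [seq o.1 + o.2 | o <- outcomes initial].
Proof.
case: (outcomes initial) (@outcomes_neq0 initial) => // o os _.
by exists (o.1 + o.2); rewrite mem_head.
Qed.

Definition Zg : nat := ex_minn total_seeds_ex.

End Game.

(* [None] is the centre and [Some i] are the leaves. *)
Definition star_edge n (x y : option 'I_n) : bool := isSome x (+) isSome y.

Lemma star_edge_sym n : symmetric (@star_edge n).
Proof. by move=> x y; rewrite /star_edge addbC. Qed.

Lemma star_edge_irrefl n : irreflexive (@star_edge n).
Proof. by move=> x; rewrite /star_edge addbb. Qed.

Definition star n : sgraph := SGraph (@star_edge_sym n) (@star_edge_irrefl n).

Lemma star_connected n (x y : star n) : connect (@edge (star n)) x y.
Proof.
have to_c (z : star n) : connect (@edge (star n)) z None.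
  by case: z => [i|]; [apply: connect1 | apply: connect0].
have from_c (z : star n) : connect (@edge (star n)) None z.
  by case: z => [i|]; [apply: connect1 | apply: connect0].
exact: connect_trans (to_c x) (from_c y).
Qed.

Lemma star_has_edge n : 0 < n -> exists x y : star n, edge x y.
Proof. by move=> n_gt0; exists None, (Some (Ordinal n_gt0)). Qed.

(* Main.v *)
Require Import Defs.
From mathcomp Require Import all_boot.
From mathcomp Require Import zify.

(** On a star, a force either colours the centre or is made by the owner of the
    centre onto the last white leaf. As the parity of the number of vertices
    decides who moves last, Alice makes at most two forces if [n] is even and at
    most one if [n] is odd; any force of hers needs her to own the centre, and
    then Bob never forces. Alice reaches her bound: she seeds a leaf, the Force
    Preservation Rule keeps Bob off the centre, and she forces the centre. *)

Lemma In_legal_moves {G : sgraph} (P : position G) (m : move G) :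
  List.In m (legal_moves P) <->
  match m with
  | Seed v => legal_seed P v
  | Force u v => legal_force (turn P) P u v
  end.
Proof.
have In_map (T : eqType) (f : T -> move G) (s : seq T) :
    List.In m (map f s) <-> exists2 x, x \in s & m = f x.
  elim: s => [|x s IHs] /=; first by split=> // -[].
  rewrite IHs; split=> [[<-|[y ys ->]]|[y]].
  - by exists x; rewrite ?mem_head.
  - by exists y; rewrite // inE ys orbT.
  by rewrite inE => /predU1P[->|ys] ->; [left | right; exists y].
rewrite /legal_moves List.in_app_iff !In_map.
split=> [[[v]|[uv]]|]; first by rewrite mem_filter => /andP[] ? _ ->.
  by rewrite mem_filter => /andP[] ? _ ->.
case: m {In_map} => [v lv|u v luv]; [left; exists v | right; exists (u, v)] => //.
  by rewrite mem_filter lv mem_enum.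
by rewrite mem_filter luv mem_enum.
Qed.

Lemma mem_flatten_mapP {T : Type} {S : eqType} (f : T -> seq S) (s : seq T) (o : S) :
  o \in flatten (map f s) <-> exists2 m, List.In m s & o \in f m.
Proof.
elim: s => [|x s IHs] /=; first by split=> // -[].
rewrite mem_cat; split=> [/orP[ox|/IHs[m ms om]]|[m [<- -> //|ms om]]].
- by exists x; [left|].
- by exists m; [right|].
by apply/orP; right; apply/IHs; exists m.
Qed.

Lemma mem_outcomes {G : sgraph} {P : position G} {o : nat * nat} :
  whites P != set0 -> o \in outcomes P ->
  (exists2 m, List.In m (legal_moves P) & o \in outcomes (play P m)) /\
  (forall m o', List.In m (legal_moves P) -> o' \in outcomes (play P m) ->
     score (turn P) o <= score (turn P) o').
Proof.
move=> wP; rewrite outcomesE (negPf wP) mem_filter => /andP[/allP o_min oU].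
split=> [|m o' lm o'm]; first exact/mem_flatten_mapP.
by apply: o_min; apply/mem_flatten_mapP; exists m.
Qed.

(** Each outcome of [P] is the seed count of a terminal position reached by legal moves, whichever
    choices are optimal; so a property kept by all legal moves constrains every outcome. *)
Lemma outcomes_invariant {G : sgraph} {I : position G -> Prop}
    (I_play : forall P m, List.In m (legal_moves P) -> I P -> I (play P m))
    {P : position G} {o : nat * nat} :
  I P -> o \in outcomes P ->
  exists P', [/\ I P', whites P' = set0 & o = (seedsA P', seedsB P')].
Proof.
have [k] := ubnP #|whites P|; elim: k P => // k IHk P leP IP.
have [w0|wP] := eqVneq (whites P) set0.
  by rewrite outcomesE w0 eqxx inE => /eqP ->; exists P.
case/(mem_outcomes wP)=> -[m lm om] _.
apply: IHk om; last exact: I_play.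
by rewrite (size_whites_play lm) in leP.
Qed.

(** The mover keeps only outcomes minimising their own score, so a single outcome after [m], which
    exists by [outcomes_neq0], bounds them all. This turns a strategy of the mover into a bound. *)
Lemma outcomes_score_le {G : sgraph} {P : position G} {m : move G} {b : nat} :
  whites P != set0 -> List.In m (legal_moves P) ->
  {in outcomes (play P m), forall o, score (turn P) o <= b} ->
  {in outcomes P, forall o, score (turn P) o <= b}.
Proof.
move=> wP lm le_b o /(mem_outcomes wP)[_ /(_ m)].
case: (outcomes _) (@outcomes_neq0 G (play P m)) le_b => // o' U _ le_b o_min.
by apply: leq_trans (o_min _ lm (mem_head _ _)) _; apply/le_b/mem_head.
Qed.

Section Star.
Context {n : nat}.
Implicit Type P : position (star n).
Local Notation centre := (None : star n).

Lemma star_force_to_centre {p} {P} {u} {v} :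
  colour P centre = None -> legal_force p P u v -> v = centre.
Proof.
move=> c0 /andP[/eqP cu /eqP/setP/(_ v)]; rewrite !inE eqxx /= => /andP[_].
case: u cu => [i|]; last by rewrite c0.
by case: v.
Qed.

(** A leaf has no white neighbour now, so the forcing vertex is the centre, and its white neighbours
    are all the white vertices. *)
Lemma star_force_from_centre {p} {P} {u} {v} : colour P centre <> None ->
  legal_force p P u v -> colour P centre = Some p /\ whites P = [set v].
Proof.
move=> c1 /andP[/eqP cu /eqP wu].
have: v \in white_nbrs P u by rewrite wu set11.
rewrite !inE => /andP[/eqP cv]; case: v cv wu => [j|] // cv wu.
case: u cu wu => [i|] // cu wu _; split=> //; rewrite -wu.
by apply/setP=> -[x|]; rewrite !inE /= ?andbT // andbF; apply/eqP.
Qed.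

Lemma star_centre_force {p} {P} {v} : colour P centre = Some p ->
  whites P = [set v] -> legal_force p P centre v.
Proof.
move=> cP wP; rewrite /legal_force cP eqxx /=; apply/eqP; rewrite -wP.
apply/setP=> -[x|]; rewrite !inE /= ?andbT // andbF.
by apply/esym/eqP; rewrite cP.
Qed.

(* [t] moves have been played and [d] of them were forces by Alice. *)
Definition star_invariant P : Prop := exists t d,
  [/\ #|whites P| + t = n.+1, turn P = player_of_bool (~~ odd t),
      seedsA P + d = uphalf t, seedsB P <= half t &
      match colour P centre with
      | None => d = 0 /\ seedsB P = half t
      | Some Alice => d <= 1 + ((#|whites P| == 0) && odd t) /\ seedsB P = half t
      | Some Bob => d = 0
      end].

Lemma star_invariant_play P m : List.In m (legal_moves P) ->
  star_invariant P -> star_invariant (play P m).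
Proof.
move=> lm [t [d [wt tP sA sB cP]]]; have wm := size_whites_play lm.
move/In_legal_moves: lm; case: m wm => [v|u v] wm lm.
  exists t.+1, d.
  have /eqP cv : colour P v == None by case/andP: lm => /andP[]; rewrite inE.
  move: #|whites (play _ _)| wm => w wm; rewrite wm in wt cP; rewrite /= ffunE; move: cP; rewrite tP.
  (* Seeding the white centre: no force has been made so far, so [d] is 0 and Bob's seeds number
     exactly [half t], whoever takes the centre. *)
  case: (eqVneq centre v) => [->|_].
    rewrite cv => -[d0 ->]; subst d.
    by case ot: (odd t) => /=; split=> //; lia.
  case: (colour P centre) => [[]|] => cP; case ot: (odd t) => /=;
    by split=> //; lia.
have [c0|c0] := eqVneq (colour P centre) None.
  have ev := star_force_to_centre c0 lm; subst v.
  move: cP; rewrite c0 => -[d0 eB]; subst d.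
  (* This is the first force of the game; it counts in [d] exactly when [t] is even, that is, when
     Alice moves. *)
  exists t.+1, (~~ odd t : nat); move: #|whites (play _ _)| wm => w wm; rewrite wm in wt.
  by rewrite /= ffunE eqxx tP; case ot: (odd t) => /=; split=> //; lia.
have [cp wv] := star_force_from_centre (elimN eqP c0) lm.
have w0 : #|whites (play P (Force u v))| = 0 by move: wm; rewrite wv cards1 => -[].
have v_leaf : (centre == v) = false.
  by apply: contraNF c0 => /eqP->; have /setP/(_ v) := wv; rewrite !inE eqxx.
(* A force by the owner of the centre ends the game; only this move can raise [d] to 2. *)
exists t.+1, (d + ~~ odd t); rewrite w0 /= ffunE v_leaf.
move: cP; rewrite cp tP; rewrite wv cards1 in wt.
by case ot: (odd t) => /=; split=> //; lia.
Qed.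

Lemma star_invariant_initial : star_invariant (initial (star n)).
Proof.
exists 0, 0; rewrite /= ffunE; split=> //; rewrite addn0.
by rewrite -[n in n.+1]card_ord -card_option; apply: eq_card => x; rewrite !inE ffunE.
Qed.

(* Alice forced the centre and seeds thereafter, except for a possible last force. *)
Definition star_centre_forced P : Prop := exists t,
  [/\ #|whites P| + t = n.+1, turn P = player_of_bool (~~ odd t),
      colour P centre = Some Alice &
      seedsA P + (1 + ((#|whites P| == 0) && odd t)) = uphalf t].

Lemma star_centre_forced_play P m : List.In m (legal_moves P) ->
  star_centre_forced P -> star_centre_forced (play P m).
Proof.
move=> lm [t [wt tP cP sA]]; have wm := size_whites_play lm.
exists t.+1; move/In_legal_moves: lm; case: m wm => [v|u v] wm lm.
  have /andP[/andP[wv nf] _] := lm.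
  have cv : (centre == v) = false.
    by apply: contraTF wv => /eqP<-; rewrite inE cP.
  (* On Alice's turn a last white leaf is the target of a force from her centre, hence no available
     seed: a seed of hers cannot end the game. *)
  have w1 : ~~ odd t -> #|whites (play P (Seed v))| != 0.
    move=> et; apply: contra nf => /eqP w0; rewrite w0 in wm.
    move/eqP/cards1P: wm => [x wx]; apply/existsP; exists centre.
    move: wv; rewrite wx inE => /eqP ev; subst x.
    by apply: star_centre_force wx; rewrite tP et.
  move: #|whites (play _ _)| wm w1 => w wm; rewrite wm in wt sA; rewrite /= ffunE cv tP.
  case ot: (odd t) => /=; split=> //; lia.
have c1 : colour P centre <> None by rewrite cP.
have [cp wv] := star_force_from_centre c1 lm.
have w0 : #|whites (play P (Force u v))| = 0 by move: wm; rewrite wv cards1 => -[].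
have cv : (centre == v) = false.
  have : v \in whites P by rewrite wv set11.
  by apply: contraTF => /eqP<-; rewrite inE cP.
rewrite w0 /= ffunE cv; rewrite wv cards1 in wt sA.
by move: cp; rewrite cP tP; case ot: (odd t) => //= _; split=> //; lia.
Qed.

Lemma star_centre_forced_score {P} :
  star_centre_forced P ->
  {in outcomes P, forall o, o.1 <= uphalf n.+1 - (1 + odd n.+1)}.
Proof.
move=> fP o oP.
have [P' [[t [wt _ _ sA]] w0 ->]] :=
  outcomes_invariant star_centre_forced_play fP oP.
rewrite w0 cards0 /= in wt sA *; lia.
Qed.

Lemma legal_force_initial p (u v : star n) :
  legal_force p (initial (star n)) u v = false.
Proof. by rewrite /legal_force ffunE. Qed.

(** Bob owns no vertex and so cannot force. The second leaf [j] offers him a seed that blocks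
    nothing, so the Force Preservation Rule forbids the centre, whose seeding would block Alice's
    force from [i]. *)
Lemma star_Bob_second_move (i j : 'I_n) (m : move (star n)) : i != j ->
  let P := play (initial (star n)) (Seed (Some i : star n)) in
  List.In m (legal_moves P) -> exists k : 'I_n, m = Seed (Some k : star n) /\ k != i.
Proof.
move=> ij P /In_legal_moves.
have noB u v : legal_force Bob P u v = false.
  by rewrite /legal_force !ffunE; case: ifP.
case: m => [v|u v]; last by rewrite noB.
case/andP=> /andP[wv _]; case: v wv => [k|] wv.
  by exists k; split=> //; apply: contraTN wv => /eqP->; rewrite !inE !ffunE eqxx.
have forceA (Q : position (star n)) : colour Q centre = None ->
    colour Q (Some i : star n) = Some Alice -> legal_force Alice Q (Some i) centre.
  move=> c0 ci; rewrite /legal_force ci eqxx; apply/eqP/setP=> -[x|].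
    by rewrite !inE andbF.
  by rewrite !inE c0.
have -> : blocks P (Seed centre).
  apply/existsP; exists (Some i); apply/existsP; exists centre.
  rewrite forceA ?ffunE ?eqxx //=; apply/negP=> /andP[_ /eqP/setP/(_ centre)].
  by rewrite !inE !ffunE eqxx.
rewrite implyTb => /forallP/(_ (Some j))/implyP bj.
have /bj : available_seed P (Some j : star n).
  rewrite /available_seed !inE !ffunE.
  have -> : (Some j == Some i :> star n) = false by apply: contraNF ij => /eqP[->].
  by apply/existsPn=> u; rewrite noB.
(* Alice's only force is from [i] to the centre, and it survives a seed on [j]. *)
case/existsP=> u /existsP[v /andP[/= Puv /negP[]]].
have ev : v = centre by apply: star_force_to_centre Puv; rewrite !ffunE.
subst v.
have eu : u = Some i.
  by case/andP: Puv; rewrite !ffunE; case: ifP => [/eqP|].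
by subst u; apply: forceA; rewrite !ffunE // eqxx; case: eqP => // -[e]; rewrite e eqxx in ij.
Qed.

Lemma star_initial_score : 3 <= n ->
  {in outcomes (initial (star n)), forall o, o.1 <= uphalf n.+1 - (1 + odd n.+1)}.
Proof.
move=> n_ge3; pose i : 'I_n := Ordinal (ltnW (ltnW n_ge3)).
pose j : 'I_n := Ordinal (ltnW n_ge3).
have card0 : #|whites (initial (star n))| = n.+1.
  rewrite -[n in n.+1]card_ord -card_option.
  by apply: eq_card => x; rewrite !inE ffunE.
have lm0 : List.In (Seed (Some i : star n)) (legal_moves (initial (star n))).
  apply/In_legal_moves/andP; split.
    rewrite /available_seed !inE ffunE eqxx /=.
    by apply/existsPn=> u; rewrite legal_force_initial.
  apply/implyP=> /existsP[u /existsP[v]].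
  by rewrite legal_force_initial.
apply: (@outcomes_score_le _ (initial (star n)) _ _ _ lm0).
  by rewrite -card_gt0 card0.
have card1 := size_whites_play lm0; rewrite card0 in card1; case: card1 => card1.
(* At Bob's turn the bound has to hold after each of his legal moves, all of which seed a leaf. *)
move=> o /mem_outcomes; case; first by rewrite -card_gt0 -card1; lia.
case=> m lm om _; have card2 := size_whites_play lm.
have [k [em ki]] := star_Bob_second_move i j m isT lm.
subst m; rewrite -card1 in card2.
set P := play _ _ in om card2; move: o om.
have iP : colour P (Some i : star n) = Some Alice.
  by rewrite !ffunE eqxx; case: eqP => // -[e]; rewrite e eqxx in ki.
have cP : colour P centre = None by rewrite !ffunE.
have lmP : List.In (Force (Some i : star n) centre) (legal_moves P).
  apply/In_legal_moves; rewrite /legal_force iP eqxx.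
  apply/eqP/setP=> -[x|]; rewrite in_set in_set1 inE ?andbF //.
  by rewrite cP.
apply: (@outcomes_score_le _ P _ _ _ lmP).
  by rewrite -card_gt0; lia.
have card3 := size_whites_play lmP.
(* Three moves: two leaf seeds and Alice's force. As [n] is at least 3, a leaf is still white, so
   the term for a last force is 0 here. *)
apply: star_centre_forced_score; exists 3; split=> //.
- lia.
- by rewrite ffunE eqxx.
by rewrite andbT (_ : _ == 0 = false) //; lia.
Qed.

End Star.

Theorem proposition10 (n : nat) (n_ge3 : 3 <= n) :
  Zg (star n) = if odd n then n else n - 1.
Proof.
rewrite /Zg; case: ex_minnP => s /mapP[o o_opt ->] _.
have := star_initial_score n_ge3 o o_opt.
(* At the end [t] is [n.+1]. The bound on Alice's seeds gives [d >= 1 + odd n.+1], which excludes a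
   white centre or one owned by Bob; for Alice's centre the invariant gives equality and
   [seedsB P = half t]. So every optimal outcome has total [n.+1 - d]. *)
have [P [[t [d [wt _ sA _ cP]]] w0 ->]] :=
  outcomes_invariant star_invariant_play star_invariant_initial o_opt.
rewrite w0 cards0 /= in wt sA cP *.
by case: (colour P None) cP => [[]|]; case: ifP; lia.
Qed.
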